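(* Let $\mathcal{H}$ be an $r$-uniform hypergraph with $m$ edges, where $r\ge 3$ and $m\ge 2$. If $\rho(\mathcal{H})\ge 2$ and $m\ge \frac{\rho(\mathcal{H})^3}{2}+1$, then $P_l(\mathcal{H},k)=P(\mathcal{H},k)$ holds for every positive integer $k$ with $$k\ge \frac{2.4(m-1)}{\rho(\mathcal{H})\log(m-1)}.$$
   Context: All hypergraphs $\mathcal{H}$ are finite, with vertex set $V(\mathcal{H})$ and edge set $E(\mathcal{H})$ (a set of subsets of $V(\mathcal{H})$), where $|e|\ge 2$ for every edge $e$ and $e_1\not\subseteq e_2$ for any two distinct edges $e_1,e_2$. $\mathcal{H}$ is $r$-uniform if $|e|=r$ for every edge $e$. $\mathbb{N}$ is the set of positive integers, $[k]=\{1,\dots,k\}$, and $\log$ is the natural logarithm. For $\mathcal{H}$ with at least two edges, $\rho(\mathcal{H}):=\min\{|e\setminus e'| : e\ne e',\ e,e'\in E(\mathcal{H})\}$. For $k\in\mathbb{N}$, a proper $k$-coloring of $\mathcal{H}$ is a map $\theta:V(\mathcal{H})\to[k]$ such that $|\{\theta(v): v\in e\}|\ge 2$ for each edge $e$; $P(\mathcal{H},k)$ is the number of proper $k$-colorings. A $k$-assignment $L$ of $\mathcal{H}$ assigns to each vertex $v$ a set $L(v)\subseteq\mathbb{N}$ with $|L(v)|=k$. An $L$-coloring is a map $\theta:V(\mathcal{H})\to\mathbb{N}$ with $\theta(v)\in L(v)$ for all $v$ and $|\{\theta(v): v\in e\}|\ge 2$ for each edge $e$; $P(\mathcal{H},L)$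 is the number of $L$-colorings. The list-color function $P_l(\mathcal{H},k)$ is the minimum of $P(\mathcal{H},L)$ over all $k$-assignments $L$ of $\mathcal{H}$. *)

(* Defs.v *)
(* Finite combinatorics over finTypes; boolp only supplies the decidability
   needed to take a minimum over all list assignments. *)
From HB Require Import structures.
From mathcomp Require Import all_boot.
From mathcomp Require Import finmap.
From mathcomp Require Import boolp.

Set Implicit Arguments.
Unset Strict Implicit.
Unset Printing Implicit Defensive.

Local Open Scope nat_scope.

Record hypergraph := Hypergraph {
  vertex : finType;
  edges : {set {set vertex}};
  edges_card : forall e, e \in edges -> 2 <= #|e|;
  edges_antichain : forall e1 e2, e1 \in edges -> e2 \in edges ->
    e1 != e2 -> ~~ (e1 \subset e2)
}.

Definition uniform (r : nat) (H : hypergraph) : Prop :=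
  forall e, e \in edges H -> #|e| = r.

(* The default value #|vertex H| bounds every #|e :\: e'| from above, so it does
   not affect the minimum as soon as H has two edges. *)
Definition rho (H : hypergraph) : nat :=
  \big[minn/#|vertex H|]_(p in setX (edges H) (edges H) | p.1 != p.2)
     #|p.1 :\: p.2|.

Definition non_monochromatic (H : hypergraph) (C : choiceType)
    (theta : vertex H -> C) : bool :=
  [forall e in edges H, 2 <= #|` [fset theta v | v in e]%fset |].

(* The k colours are the elements 0, ..., k-1 of 'I_k instead of 1, ..., k. *)
Definition num_colorings (H : hypergraph) (k : nat) : nat :=
  #|[set theta : {ffun vertex H -> 'I_k} | non_monochromatic theta]|.

Definition assignment (H : hypergraph) (k : nat)
    (L : vertex H -> {fset nat}) : Prop :=
  forall v, #|` L v| = k /\ (forall c, c \in L v -> 0 < c).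

(* An L-coloring is encoded as a dependent function picking, for each vertex v,
   an element of the finite type of members of L v. *)
Definition num_list_colorings (H : hypergraph)
    (L : vertex H -> {fset nat}) : nat :=
  #|[set theta : {dffun forall v : vertex H, L v} |
      non_monochromatic (fun v => val (theta v))]|.

Definition list_value (H : hypergraph) (k n : nat) : Prop :=
  exists L : vertex H -> {fset nat},
    assignment k L /\ num_list_colorings L = n.

Lemma list_value_ex (H : hypergraph) (k : nat) :
  exists n, `[< list_value H k n >].
Proof.
pose L (_ : vertex H) := [fset i in iota 1 k]%fset.
exists (num_list_colorings L); apply/asboolP; exists L; split=> // v.
split=> [|c]; last by rewrite !inE mem_iota => /andP[].
by rewrite card_fseq undup_id ?iota_uniq // size_iota.
Qed.

Definition list_color_function (H : hypergraph) (k : nat) : nat :=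
  ex_minn (list_value_ex H k).

(* Main.v *)
(** Deleting and contracting the edges one after the other writes the number of
    [L]-colorings as a signed sum, over the leaves [B] of the deletion-contraction tree, of
    the number [N_L(B)] of [L]-choices that are constant on every edge of [B]; branches in
    which an unprocessed edge has collapsed to a point contribute nothing and are cut. The
    leaves do not depend on [L], and for constant lists [N_L(B) = k^c(B)], where [c(B)] is
    the number of components. With [n] vertices, in general [k^c(B) - N_L(B)] lies between [0] and [k^(c(B)-1)]
    times the sum of the defects [k - |L(e)|], [e] in [B], where [L(e)] is the set of colors
    common to the lists on [e]; for a single edge it is [k^(n-r)] times the defect. Every
    contraction lowers [c] by at least [1], and the second one by at least [rho] as long as
    [rho < r], so leaves with [j >= 2] edges satisfy [c(B) - 1 <= n - r - rho - (j - 2)].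
    Hence each edge's gain in the single-edge terms outweighs its losses in the terms with
    [j] even as soon as [(1 + 1/k)^(m-1) <= 2 k^(rho-1)], and this follows from the
    hypotheses by taking logarithms. If [rho = r] the edges are disjoint and the count is a
    product. *)
Require Import Defs.
From mathcomp Require Import all_boot all_order all_algebra.
From mathcomp Require Import finmap ring lra zify.
Import Order.TTheory GRing.Theory Num.Theory.

Set Implicit Arguments.
Unset Strict Implicit.
Unset Printing Implicit Defensive.

Local Open Scope nat_scope.

(** * Connected components generated by a set of edges *)

Section Components.
Variable V : finType.
Implicit Types (A B : {set {set V}}) (e : {set V}).

Definition linked A : rel V :=
  fun x y => [exists e in A, (x \in e) && (y \in e)].

(* Two vertices lie in the same component of [A] iff they have the same [crep]. *)
Definition crep A x := fingraph.root (linked A) x.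

Definition ncomp A := #|[set t | crep A t == t]|.

Definition spanned A e := #|crep A @: e| <= 1.

Lemma linkedP A x y :
  reflect (exists e, [/\ e \in A, x \in e & y \in e]) (linked A x y).
Proof.
apply: (iffP existsP) => [[e /and3P[]]|[e [eA xe ye]]]; first by exists e.
by exists e; rewrite eA xe.
Qed.

Lemma linked_connect_sym A : connect_sym (linked A).
Proof.
apply: sym_connect_sym => x y.
by apply/linkedP/linkedP => -[e [? ? ?]]; exists e.
Qed.

Lemma crepP A x y : reflect (crep A x = crep A y) (connect (linked A) x y).
Proof. exact: (fingraph.rootP (linked_connect_sym A)). Qed.

Lemma crepK A x : crep A (crep A x) = crep A x.
Proof. exact: (root_root (linked_connect_sym A)). Qed.

Lemma crep_edge A e x y : e \in A -> x \in e -> y \in e -> crep A x = crep A y.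
Proof. by move=> eA xe ye; apply/crepP/connect1/linkedP; exists e. Qed.

Lemma crep_sub A B x y : A \subset B -> crep A x = crep A y ->
  crep B x = crep B y.
Proof.
move=> AB /crepP xy; apply/crepP; apply: connect_sub xy => u v /linkedP[e [eA ue ve]].
by apply/connect1/linkedP; exists e; split=> //; apply: (subsetP AB).
Qed.

(** A path from [x] to [y] moves inside one edge at a time. With boolean [f], this shows that a set
    closed under edges is a union of components. *)
Lemma crep_invariant A (T : Type) (f : V -> T) x y :
  (forall e u v, e \in A -> u \in e -> v \in e -> f u = f v) ->
  crep A x = crep A y -> f x = f y.
Proof.
move=> fA /crepP/connectP[p]; elim: p x => [|z p IH] x /=; first by move=> _ ->.
by case/andP=> /linkedP[e [eA xe ze]] /IH h /h <-; apply: fA eA xe ze.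
Qed.

Lemma crep0 x : crep set0 x = x.
Proof.
apply: (@crep_invariant set0 V id); first by move=> e u v; rewrite inE.
by rewrite crepK.
Qed.

(** The invariants used are membership in [e] and, for [x] outside [e], equality with [x]. *)
Lemma crep1 e x y : crep [set e] x = crep [set e] y ->
  x = y \/ (x \in e) && (y \in e).
Proof.
move=> xy; case: (boolP (x \in e)) => xe.
  have h : (x \in e) = (y \in e).
    apply: crep_invariant xy => f u v; rewrite inE => /eqP-> ue ve.
    exact: etrans ue (esym ve).
  by right; rewrite -h xe.
left; have: (x == x) = (x == y).
  apply: (@crep_invariant [set e] bool (fun z => x == z)) xy.
  have xN w : w \in e -> (x == w) = false.
    by move=> we; apply/eqP => xw; rewrite xw we in xe.
  by move=> f u v; rewrite inE => /eqP-> ue ve; rewrite !xN.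
by rewrite eqxx => /esym/eqP.
Qed.

Lemma ncomp0 : ncomp set0 = #|V|.
Proof. by rewrite -cardsT; apply: eq_card => x; rewrite !inE crep0 eqxx. Qed.

Lemma ncomp_gt0 A (x : V) : 0 < ncomp A.
Proof. by apply/card_gt0P; exists (crep A x); rewrite inE crepK. Qed.

(** The components met by [e] merge into one. The representatives of the other new components have
    distinct old representatives, none of them met by [e]. *)
Lemma ncompU1 A e : e != set0 -> ncomp (e |: A) + #|crep A @: e| <= ncomp A + 1.
Proof.
case/set0Pn=> x xe; set A' := e |: A.
have AA' : A \subset A' by apply: subsetUr.
have eA' : e \in A' by rewrite !inE eqxx.
pose T := [set t | crep A' t == t] :\ crep A' x.
have inT t : t \in T -> crep A' t = t /\ t != crep A' x.
  by rewrite !inE => /andP[-> /eqP].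
have cT : ncomp A' = #|T|.+1.
  by rewrite /ncomp (cardsD1 (crep A' x)) inE crepK eqxx.
have injT : {in T &, injective (crep A)}.
  move=> t u /inT[tE _] /inT[uE _] /(crep_sub AA').
  by rewrite tE uE.
rewrite cT -(card_in_imset injT) addSn addn1 ltnS.
have dis : [disjoint crep A @: T & crep A @: e].
  apply/pred0P => z /=; apply/negP => /andP[/imsetP[t /inT[tE tx] ->]].
  case/imsetP=> y ye /(crep_sub AA'); rewrite tE (crep_edge eA' ye xe) => E.
  by rewrite E eqxx in tx.
move: (dis); rewrite -leq_card_setU => /eqP <-.
apply/subset_leq_card/subsetP => z; rewrite !inE.
by case/orP=> /imsetP[t _ ->]; rewrite crepK.
Qed.

Lemma spannedN_card A e : ~~ spanned A e -> e != set0.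
Proof. by apply: contraNneq => ->; rewrite /spanned imset0 cards0. Qed.

Lemma ncompU1_lt A e : ~~ spanned A e -> ncomp (e |: A) < ncomp A.
Proof.
move=> nsp; have := ncompU1 A (spannedN_card nsp).
by move: nsp; rewrite /spanned -ltnNge => h; lia.
Qed.

Lemma crep_set0_card e : #|crep set0 @: e| = #|e|.
Proof. by apply: card_imset => x y; rewrite !crep0. Qed.

(** The vertices of [e] outside [e'] stay isolated, and a common vertex adds the component [e']. *)
Lemma crep_set1_card e e' : e :&: e' != set0 ->
  #|e :\: e'| < #|crep [set e'] @: e|.
Proof.
case/set0Pn=> z; rewrite inE => /andP[ze ze'].
have injD : {in e :\: e' &, injective (crep [set e'])}.
  move=> x y; rewrite !inE => /andP[xe' _] _ /crep1[//|].
  by rewrite (negPf xe').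
have nz : crep [set e'] z \notin crep [set e'] @: (e :\: e').
  apply/imsetP => -[x]; rewrite !inE => /andP[xe' xe] /crep1.
  by case=> [E|/andP[_ h]]; [move: xe'; rewrite -E ze' | rewrite h in xe'].
rewrite -(card_in_imset injD).
have <- : #|crep [set e'] z |: crep [set e'] @: (e :\: e')| =
    #|crep [set e'] @: (e :\: e')|.+1 by rewrite cardsU1 nz.
apply/subset_leq_card/subsetP => t; rewrite !inE => /orP[/eqP->|].
  exact: imset_f.
by case/imsetP=> x; rewrite inE => /andP[_ xe] ->; apply: imset_f.
Qed.

End Components.

(** * Counting colorings that are constant on prescribed edges *)

Section Counting.
Variables (V C : finType) (L : V -> {set C}).
Implicit Types (A B : {set {set V}}) (e U : {set V}) (es : seq {set V}).
Implicit Types theta : {ffun V -> C}.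

Definition mono (f : V -> C) e := [forall x in e, forall y in e, f x == f y].

Definition respects theta := [forall v, theta v \in L v].

(** [A] holds the contracted edges, [es] those still to be processed. Contraction is only a
    constancy condition, so the vertex set never changes. *)
Definition count_col A es := #|[set theta | [&& respects theta,
  [forall e in A, mono theta e] & all (fun e => ~~ mono theta e) es]]|.

Definition common U := [set c | [forall v in U, c \in L v]].

Definition cls A t := [set v | crep A v == crep A t].

Lemma monoP (f : V -> C) e :
  reflect {in e &, forall x y, f x = f y} (mono f e).
Proof.
apply: (iffP forall_inP) => [h x y xe ye | h x xe].
  exact/eqP/(forall_inP (h x xe)).
by apply/forall_inP => y ye; apply/eqP/h.
Qed.

Lemma commonP U c : reflect {in U, forall v, c \in L v} (c \in common U).
Proof. by rewrite inE; apply: forall_inP. Qed.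

(** Deletion-contraction: colorings are split by whether they are constant on [e]. *)
Lemma count_col_cons A e es :
  count_col A (e :: es) + count_col (e |: A) es = count_col A es.
Proof.
rewrite /count_col addnC -(cardsID [set theta : {ffun V -> C} | mono theta e]
  [set theta | [&& _, [forall e in A, _] & all _ es]]).
congr addn; apply: eq_card => theta; rewrite !inE /=; last first.
  by case: (respects theta); rewrite //= ?andbF // andbCA.
have -> : [forall e0 in e |: A, mono theta e0] =
    mono theta e && [forall e0 in A, mono theta e0].
  apply/forall_inP/andP => [h|[he /forall_inP h] f].
    split; first by apply: h; rewrite !inE eqxx.
    by apply/forall_inP => f fA; apply: h; rewrite !inE fA orbT.
  by rewrite !inE => /orP[/eqP->|/h].
by case: (mono theta e); rewrite ?andbF ?andbT.
Qed.

Lemma mono_crep A theta x y : [forall e in A, mono theta e] ->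
  crep A x = crep A y -> theta x = theta y.
Proof.
move=> /forall_inP h; apply: crep_invariant => e u v eA ue ve.
exact: (monoP _ _ (h e eA)).
Qed.

Lemma spanned_crep A e x y : spanned A e -> x \in e -> y \in e ->
  crep A x = crep A y.
Proof. by move=> /card_le1_eqP h xe ye; apply: h; apply: imset_f. Qed.

Lemma count_col_spanned A e es : e \in es -> spanned A e -> count_col A es = 0.
Proof.
move=> ees sp; apply/eqP; rewrite cards_eq0; apply/eqP/setP => theta.
rewrite !inE; apply/negP => /and3P[_ hA /allP /(_ e ees) /negP]; apply.
by apply/monoP => x y xe ye; apply: (mono_crep hA); apply: spanned_crep sp xe ye.
Qed.

(** Such a coloring is a free choice, for each component, of a color common to its lists. *)
Lemma count_col_nil (c0 : C) A :
  count_col A [::] = \prod_(t | crep A t == t) #|common (cls A t)|.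
Proof.
pose D := [set t | crep A t == t].
pose F t := common (cls A t).
(* The value [c0] off the representatives makes the correspondence between choices and colorings
   bijective. *)
transitivity #|pfamily c0 (mem D) (fun t => mem (F t))|.
  pose g (theta : {ffun V -> C}) := [ffun v => theta (crep A v)].
  have inP (theta : {ffun V -> C}) : theta \in pfamily c0 (mem D) (fun t => mem (F t)) ->
      (forall t, t \notin D -> theta t = c0) /\
      (forall t, t \in D -> theta t \in F t).
    by move=> /pfamilyP[/supportP h1 h2]; split.
  rewrite -(@card_in_imset _ _ g); first last.
    move=> f1 f2 /inP[f1N _] /inP[f2N _] /ffunP E; apply/ffunP => t.
    case: (boolP (t \in D)) => tD; last by rewrite f1N ?f2N.
    by move: (E t); rewrite !ffunE; move: tD; rewrite inE => /eqP->.
  apply: eq_card => theta; rewrite inE andbT; apply/andP/imsetP.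
    case=> /forallP hL hA.
    exists [ffun t => if t \in D then theta t else c0]; last first.
      apply/ffunP => v; rewrite !ffunE inE crepK eqxx.
      by apply: (mono_crep hA); rewrite crepK.
    apply/pfamilyP; split.
      by apply/supportP => t tD; rewrite ffunE (negPf tD).
    move=> t tD; rewrite ffunE tD; apply/commonP => v.
    by rewrite inE => /eqP /(mono_crep hA) <-.
  case=> f /inP[fN fD] ->; split.
    apply/forallP => v; rewrite ffunE.
    have /fD /commonP : crep A v \in D by rewrite inE crepK.
    by apply; rewrite inE crepK.
  apply/forall_inP => e eA; apply/monoP => x y xe ye; rewrite !ffunE.
  by rewrite (crep_edge eA xe ye).
rewrite card_pfamily foldrE big_map big_enum /=.
by apply: eq_bigl => t; rewrite inE.
Qed.

Section Regular.
Variables (k : nat) (c0 : C).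
Hypothesis card_L : forall v, #|L v| = k.

Definition defect U := k - #|common U|.

Lemma common_le U v : v \in U -> #|common U| <= k.
Proof.
move=> vU; rewrite -(card_L v); apply/subset_leq_card/subsetP => c /commonP.
exact.
Qed.

Lemma common1 v : #|common [set v]| = k.
Proof.
rewrite -(card_L v); apply: eq_card => c; apply/commonP/idP => [|h w].
  by apply; rewrite inE.
by rewrite inE => /eqP->.
Qed.

Lemma count_col_le A : count_col A [::] <= k ^ ncomp A.
Proof.
rewrite (count_col_nil c0) /ncomp -prod_nat_const.
rewrite [X in _ <= X](eq_bigl (fun t => crep A t == t)) => [|t]; last by rewrite inE.
elim/big_ind2: _ => // [a b c d|t _]; first exact: leq_mul.
by apply: (@common_le _ t); rewrite inE.
Qed.

Lemma count_col_const A : (forall u v, L u = L v) ->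
  count_col A [::] = k ^ ncomp A.
Proof.
move=> Lc; rewrite (count_col_nil c0) /ncomp -prod_nat_const.
rewrite [RHS](eq_bigl (fun t => crep A t == t)) => [|t]; last by rewrite inE.
apply: eq_bigr => t _; rewrite -(card_L t); apply: eq_card => c.
apply/commonP/idP => [|h w]; first by apply; rewrite inE.
by rewrite (Lc w t).
Qed.

(* Grow a set from [t] inside its component, one whole edge at a time: each new edge [e]
   meets the set, so it removes at most [defect e] colors. *)
Lemma common_cls A t :
  k <= #|common (cls A t)| + \sum_(e in A | e \subset cls A t) defect e.
Proof.
pose P U := [&& t \in U, U \subset cls A t &
  k <= #|common U| + \sum_(e in A | e \subset U) defect e].
have P1 : P [set t].
  rewrite /P inE eqxx common1 leq_addr sub1set inE eqxx //.
have [U /maxsetP[/and3P[tU Ut Uk] Umax] _] := maxset_exists P1.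
suff <- : U = cls A t by [].
apply/eqP; rewrite eqEsubset Ut; apply/subsetP => v; rewrite inE => /eqP vt.
have Uclosed e x y : e \in A -> x \in e -> y \in e -> x \in U -> y \in U.
  move=> eA xe ye xU; have : U :|: e = U; last first.
    by move=> <-; rewrite inE ye orbT.
  apply: Umax; last exact: subsetUl.
  case: (boolP (e \subset U)) => eU.
    by move: (eU) => /setUidPl->; apply/and3P.
  apply/and3P; split; first by rewrite inE tU.
    rewrite subUset Ut; apply/subsetP => z ze; move/subsetP: Ut => /(_ x xU).
    by rewrite !inE => /eqP <-; rewrite (crep_edge eA ze xe).
  have hs : \sum_(f in A | f \subset U) defect f + defect e <=
      \sum_(f in A | f \subset U :|: e) defect f.
    rewrite [X in _ <= X](bigD1 e) /=; last by rewrite eA subsetUr.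
    rewrite addnC leq_add2l big_mkcond [X in _ <= X]big_mkcond.
    apply: leq_sum => f _; case: ifP => // /andP[-> fU] /=.
    rewrite (subset_trans fU (subsetUl _ _)) /=.
    by case: eqP => // E; rewrite -E fU in eU.
  (* Both color sets lie in the list of [x], a vertex of [U] and of [e], so their union has at most
     [k] elements. *)
  have hc : #|common U| + #|common e| <= #|common (U :|: e)| + k.
    rewrite -cardsUI addnC leq_add //.
      apply/subset_leq_card/subsetP => c; rewrite inE => /andP[/commonP h1 /commonP h2].
      by apply/commonP => w; rewrite inE => /orP[/h1|/h2].
    rewrite -(card_L x); apply/subset_leq_card/subsetP => c; rewrite inE.
    by case/orP=> /commonP; apply.
  have := common_le xe; rewrite /defect in hs *.
  by move: hs Uk hc; rewrite /defect; lia.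
have h : (t \in U) = (v \in U).
  apply: (@crep_invariant _ A bool (fun z => z \in U)); last exact/esym.
  move=> e x y eA xe ye; apply/idP/idP; [exact: (Uclosed e)|exact: (Uclosed e)].
by rewrite -h.
Qed.

(** Telescoping: the factors [k] are replaced by [b i] one at a time. The extra factor [k] on both
    sides avoids a division. *)
Lemma prod_deficit (I : Type) (s : seq I) (P : pred I) (b : I -> nat) :
  (forall i, b i <= k) ->
  k * \prod_(i <- s | P i) k <=
    k * \prod_(i <- s | P i) b i +
    \prod_(i <- s | P i) k * \sum_(i <- s | P i) (k - b i).
Proof.
move=> bk; elim: s => [|i s IH]; first by rewrite !big_nil; lia.
rewrite !big_cons; case: ifP => // _.
move: IH (bk i); set p := \prod_(_ <- _ | _) k; set q := \prod_(_ <- _ | _) b _.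
set S := \sum_(_ <- _ | _) _ => IH bi.
have [d dE] : exists d, k = b i + d by exists (k - b i); lia.
have -> : k - b i = d by lia.
have : b i * (k * p) <= b i * (k * q + p * S) by rewrite leq_mul2l IH orbT.
have : b i * (p * S) <= k * (p * S) by rewrite leq_mul2r bi orbT.
have -> : k * (k * p) = b i * (k * p) + d * (k * p) by rewrite [in X in X * _ = _]dE mulnDl.
rewrite !mulnDr; lia.
Qed.

(** [prod_deficit] bounds the loss by the colors missing in each component, and [common_cls] bounds
    these by defects of edges. *)
Lemma count_col_deficit A : (forall e, e \in A -> e != set0) ->
  k * k ^ ncomp A <=
    k * count_col A [::] + k ^ ncomp A * \sum_(e in A) defect e.
Proof.
move=> A0; have -> : k ^ ncomp A = \prod_(t | crep A t == t) k.
  by rewrite -prod_nat_const; apply: eq_bigl => t; rewrite inE.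
rewrite (count_col_nil c0).
have bk t : #|common (cls A t)| <= k by apply: (@common_le _ t); rewrite inE.
apply: leq_trans (prod_deficit _ (fun t => crep A t == t) bk) _.
rewrite leq_add2l leq_mul2l; apply/orP; right.
apply: (@leq_trans (\sum_(t | crep A t == t)
    \sum_(e in A | e \subset cls A t) defect e)).
  by apply: leq_sum => t _; rewrite leq_subLR common_cls.
(* A nonempty edge lies in at most one component, so its defect is counted at most once. *)
rewrite (exchange_big_dep (fun e => e \in A)) /=; last by move=> t e _ /andP[].
apply: leq_sum => e eA; have /set0Pn[x xe] := A0 e eA.
rewrite sum_nat_cond_const -[X in _ <= X]mul1n leq_mul2r; apply/orP; right.
rewrite -(card1 (crep A x)); apply/subset_leq_card/subsetP => t; rewrite !inE.
by case/and3P=> /eqP tE _ /subsetP /(_ x xe); rewrite inE tE eq_sym.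
Qed.

End Regular.
End Counting.

(** * Leaves of the deletion-contraction tree and the signed expansion *)

Section Expansion.
Variable V : finType.
Implicit Types (A B : {set {set V}}) (e U : {set V}) (es : seq {set V}).

(* The leaves of the deletion-contraction tree: [A] is the set of contracted edges, and a
   branch dies as soon as an unprocessed edge is contracted to a point. *)
Fixpoint leaves A es : seq {set {set V}} :=
  if es is e :: es' then
    if spanned A e then [::] else leaves A es' ++ leaves (e |: A) es'
  else [:: A].

Lemma leaves_sub A es B : B \in leaves A es -> A \subset B.
Proof.
elim: es A => [|e es IH] A /=; first by rewrite inE => /eqP->.
case: ifP => // _; rewrite mem_cat => /orP[/IH//|/IH].
by apply: subset_trans; apply: subsetUr.
Qed.

Lemma sub_leaves A es B : B \in leaves A es -> {subset B <= [pred e | (e \in A) || (e \in es)]}.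
Proof.
elim: es A => [|e es IH] A /=.
  by rewrite inE => /eqP-> f fA; rewrite inE fA.
case: ifP => // _; rewrite mem_cat => /orP[|] /IH h f /h; rewrite !inE.
  by case/orP=> ->; rewrite ?orbT.
by rewrite -orbA orbCA.
Qed.

(** At each split the leaves of the contraction branch contain [e] and those of the deletion branch
    do not. *)
Lemma leaves_uniq A es : uniq es -> (forall e, e \in es -> e \notin A) ->
  uniq (leaves A es).
Proof.
elim: es A => [|e es IH] A //= /andP[ees Ues] esA.
case: ifP => // _; have eA : e \notin A by apply: esA; rewrite inE eqxx.
have h1 f : f \in es -> f \notin A by move=> fes; apply: esA; rewrite inE fes orbT.
have h2 f : f \in es -> f \notin e |: A.
  move=> fes; rewrite !inE negb_or h1 // andbT.
  by apply: contraNneq ees => <-.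
rewrite cat_uniq !IH // andbT /=; apply/hasPn => B /leaves_sub /subsetP eB.
apply/negP => /sub_leaves /(_ e (eB e _)); rewrite !inE eqxx => /(_ isT).
by rewrite (negPf eA) (negPf ees).
Qed.

Lemma leaves_self A es : (forall e, e \in es -> ~~ spanned A e) -> A \in leaves A es.
Proof.
elim: es => [|e es IH] h /=; first by rewrite inE.
rewrite (negPf (h e _)) ?inE ?eqxx // mem_cat IH // => f fes.
by apply: h; rewrite inE fes orbT.
Qed.

(** On the branch contracting only [e], the contracted set is empty and then [[set e]]; no remaining
    edge is spanned in either phase, so nothing is cut. *)
Lemma leaves_set1 es e : e \in es -> (forall f, f \in es -> ~~ spanned set0 f) ->
  (forall f, f \in es -> f != e -> ~~ spanned [set e] f) -> uniq es ->
  [set e] \in leaves set0 es.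
Proof.
elim: es => [|f es IH] //= ees h0 h1 /andP[fes Ues].
rewrite (negPf (h0 f _)) ?inE ?eqxx // mem_cat.
have h0' g : g \in es -> ~~ spanned set0 g.
  by move=> ges; apply: h0; rewrite inE ges orbT.
have h1' g : g \in es -> g != e -> ~~ spanned [set e] g.
  by move=> ges; apply: h1; rewrite inE ges orbT.
move: ees; rewrite inE => /orP[/eqP E|ees]; last by rewrite IH.
rewrite -E setU0 leaves_self ?orbT // => g ges; apply: h1' => //.
by apply: contraNneq fes => ge; rewrite -E -ge.
Qed.

(** Each contraction contributes a sign. Cutting a branch is harmless, since a coloring constant on
    the edges of [A] is constant on every edge they span. *)
Lemma count_col_leaves (R : comRingType) (C : finType) (L : V -> {set C}) A es :
  uniq es -> (forall e, e \in es -> e \notin A) ->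
  ((count_col L A es)%:R = \sum_(B <- leaves A es)
     (-1) ^+ (#|A| + #|B|) * (count_col L B [::])%:R :> R)%R.
Proof.
elim: es A => [|e es IH] A /=.
  by rewrite big_seq1 addnn -signr_odd odd_double mul1r.
move=> /andP[ees Ues] esA.
case: ifPn => [sp|_].
  by rewrite big_nil (count_col_spanned _ _ sp) // inE eqxx.
have eA : e \notin A by apply: esA; rewrite inE eqxx.
have h1 f : f \in es -> f \notin A by move=> fes; apply: esA; rewrite inE fes orbT.
have h2 f : f \in es -> f \notin e |: A.
  move=> fes; rewrite !inE negb_or h1 // andbT.
  by apply: contraNneq ees => <-.
rewrite big_cat /= -(IH A Ues h1).
have -> : (\sum_(B <- leaves (e |: A) es)
    (-1) ^+ (#|A| + #|B|) * (count_col L B [::])%:R = - (count_col L (e |: A) es)%:R :> R)%R.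
  rewrite (IH _ Ues h2) -sumrN; apply: eq_bigr => B _.
  by rewrite cardsU1 eA addSn exprS mulN1r mulNr opprK.
by rewrite -(count_col_cons L A e es) natrD addrK.
Qed.

End Expansion.

(** * Binomial sums over subsets *)

Lemma sum_subsets_expr (R : comRingType) (T : finType) (S : {set T}) (y : R) :
  (\sum_(B : {set T} | B \subset S) y ^+ #|B| = (1 + y) ^+ #|S|)%R.
Proof.
rewrite -prodr_const.
(* Factors [0 + 1] outside [S] extend the product to the whole type, where distributivity lists all
   subsets. *)
transitivity (\prod_i ((if i \in S then y else 0) + 1))%R; last first.
  by rewrite [RHS]big_mkcond; apply: eq_bigr => i _; case: ifP; rewrite ?add0r // addrC.
rewrite bigA_distr big_mkcond; apply: eq_bigr => J _; rewrite -big_mkcond /=.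
case: ifP => [JS|/negbT].
  by rewrite -prodr_const; apply: eq_bigr => i iJ; rewrite (subsetP JS).
by case/subsetPn=> i iJ iS; rewrite (bigD1 i) //= (negPf iS) mul0r.
Qed.

Lemma sum_subsets_pointed (R : comRingType) (T : finType) (S : {set T}) e (y : R) :
  e \in S ->
  (\sum_(B : {set T} | (B \subset S) && (e \in B)) y ^+ #|B|.-1 =
   (1 + y) ^+ #|S|.-1)%R.
Proof.
move=> eS; have -> : #|S|.-1 = #|S :\ e| by rewrite (cardsD1 e S) eS.
rewrite -sum_subsets_expr (reindex_onto (fun B => e |: B) (fun B => B :\ e)) /=; last first.
  by move=> B /andP[_ eB]; rewrite setD1K.
apply: eq_big => [B|B].
  rewrite !inE eqxx andbT subUset sub1set eS /= subsetD1.
  case: (boolP (e \in B)) => eB; last by rewrite setU1K // eqxx.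
  rewrite andbF; apply/negbTE/nandP; right; apply/eqP => /setP /(_ e).
  by rewrite !inE eqxx eB.
move=> /andP[_ /eqP h]; have eB : e \notin B by rewrite -h !inE eqxx.
by rewrite cardsU1 eB.
Qed.

(** * Rank of the leaves in a uniform hypergraph *)

Section RankBound.
Variables (V : finType) (E : {set {set V}}) (r p : nat).
Hypotheses (E_unif : forall e, e \in E -> #|e| = r)
  (E_diff : forall e f, e \in E -> f \in E -> e != f -> p <= #|e :\: f|)
  (p_gt1 : 1 < p) (p_ltr : p < r).
Implicit Types (A B : {set {set V}}) (e f : {set V}) (es : seq {set V}).

(* Lower bound for the rank [n - c(B)] of a leaf with [j] edges. *)
Definition rank_bound j :=
  match j with 0 => 0 | 1 => r.-1 | j'.+2 => r.-1 + p + j' end.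

Lemma crep_pair_card e f : e \in E -> f \in E -> e != f ->
  p < #|crep [set f] @: e|.
Proof.
move=> eE fE ef; have [dis|meet] := eqVneq (e :&: f) set0; last first.
  exact: leq_ltn_trans (E_diff eE fE ef) (crep_set1_card meet).
rewrite card_in_imset ?E_unif // => x y xe ye /crep1[//|/andP[xf _]].
by move/setP: dis => /(_ x); rewrite !inE xe xf.
Qed.

Lemma spanned0N e : e \in E -> ~~ spanned set0 e.
Proof.
by move=> eE; rewrite /spanned crep_set0_card E_unif // -ltnNge; lia.
Qed.

Lemma spanned1N e f : e \in E -> f \in E -> e != f -> ~~ spanned [set f] e.
Proof.
move=> eE fE ef; rewrite /spanned -ltnNge.
exact: ltn_trans p_gt1 (crep_pair_card eE fE ef).
Qed.

(** The first edge merges its [r] vertices, the second meets more than [p] components, and each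
    later one merges at least two. *)
Lemma rank_boundU1 A e : A \subset E -> e \in E -> e \notin A -> ~~ spanned A e ->
  ncomp A + rank_bound #|A| <= #|V| ->
  ncomp (e |: A) + rank_bound #|e |: A| <= #|V|.
Proof.
move=> AE eE eA sp; rewrite cardsU1 eA add1n.
have := ncompU1 A (spannedN_card sp); have := ncompU1_lt sp.
case cA : #|A| => [|[|j]] /=; last by lia.
  by move/eqP: cA; rewrite cards_eq0 => /eqP->; rewrite crep_set0_card E_unif //; lia.
move/eqP: cA => /cards1P[f fA]; rewrite fA in AE eA *.
rewrite sub1set in AE; rewrite inE in eA => _ h hn.
have := leq_trans (leq_add (leqnn _) (crep_pair_card eE AE eA)) h.
by move: hn; lia.
Qed.

Lemma leaves_rank A es B : A \subset E -> {subset es <= E} -> uniq es ->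
  (forall e, e \in es -> e \notin A) ->
  ncomp A + rank_bound #|A| <= #|V| ->
  B \in leaves A es -> ncomp B + rank_bound #|B| <= #|V|.
Proof.
elim: es A => [|e es IH] A AE esE /=; first by move=> _ _ h; rewrite inE => /eqP->.
move=> /andP[ees Ues] esA hA.
have eE : e \in E by apply: esE; rewrite inE eqxx.
have eA : e \notin A by apply: esA; rewrite inE eqxx.
have esE' : {subset es <= E} by move=> f fes; apply: esE; rewrite inE fes orbT.
have h1 f : f \in es -> f \notin A by move=> fes; apply: esA; rewrite inE fes orbT.
case: ifPn => // sp; rewrite mem_cat => /orP[|]; first exact: IH.
apply: IH => //; last exact: rank_boundU1.
  by rewrite subUset sub1set eE.
move=> f fes; rewrite !inE negb_or h1 // andbT.
by apply: contraNneq ees => <-.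
Qed.

End RankBound.

(** The vertices outside [e] and one vertex of [e] represent their own components. *)
Lemma ncomp1 (V : finType) (e : {set V}) : e != set0 ->
  #|V| < ncomp [set e] + #|e|.
Proof.
case/set0Pn=> x xe; rewrite -(cardsC e) addnC ltn_add2r /ncomp.
have /subset_leq_card : crep [set e] x |: ~: e \subset [set t | crep [set e] t == t].
  apply/subsetP => t; rewrite !inE => /orP[/eqP->|te]; first by rewrite crepK.
  have /crep1[->//|/andP[_]] := crepK [set e] t.
  by rewrite (negPf te).
apply: leq_trans; rewrite cardsU1 inE negbK.
suff -> : crep [set e] x \in e by [].
by have /crep1[->//|/andP[]] := crepK [set e] x.
Qed.

(** The component [e] has [k - defect L k e] available colors, every other component at most [k]. *)
Lemma count_col_set1 (V C : finType) (L : V -> {set C}) (k : nat) (c0 : C) (e : {set V}) :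
  (forall v, #|L v| = k) -> e != set0 ->
  k ^ (ncomp [set e]).-1 * defect L k e + count_col L [set e] [::] <=
  k ^ ncomp [set e].
Proof.
move=> cL /set0Pn[x xe]; set A := [set e]; set t0 := crep A x.
have t0K : crep A t0 == t0 by rewrite crepK.
have clsE : cls A t0 = e.
  apply/setP => v; rewrite inE crepK; apply/eqP/idP => [/crep1[->//|/andP[]//]|ve].
  by apply: (@crep_edge _ A e); rewrite ?inE.
have cE : ncomp A = (ncomp A).-1.+1 by rewrite prednK // ncomp_gt0.
rewrite (count_col_nil L c0) (bigD1 t0) //= clsE.
set q := \prod_(_ | _) _.
have qk : q <= k ^ (ncomp A).-1.
  have -> : (ncomp A).-1 = #|[pred t | (crep A t == t) && (t != t0)]|.
    rewrite /ncomp (cardsD1 t0) inE t0K /=.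
    by apply: eq_card => t; rewrite !inE andbC.
  rewrite -prod_nat_const; apply: leq_prod => t _.
  by apply: (@common_le _ _ L k cL _ t); rewrite inE.
rewrite [X in _ <= k ^ X]cE expnSr.
have bk := @common_le _ _ L k cL e x xe.
rewrite /defect; apply: (@leq_trans (k ^ (ncomp A).-1 * (k - #|common L e|) +
    #|common L e| * k ^ (ncomp A).-1)).
  by rewrite leq_add2l leq_mul2l qk orbT.
by rewrite [X in _ + X]mulnC -mulnDr subnK.
Qed.

(** * Leafwise comparison with constant lists *)

Section Comparison.
Variables (R : realFieldType) (V C : finType) (E : {set {set V}}) (L : V -> {set C}).
Variables (r p k : nat) (c0 : C).
Hypotheses (E_unif : forall e, e \in E -> #|e| = r)
  (E_diff : forall e f, e \in E -> f \in E -> e != f -> p <= #|e :\: f|)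
  (p_gt1 : 1 < p) (p_ltr : p < r) (k_gt0 : 0 < k)
  (card_L : forall v, #|L v| = k).
Implicit Types (A B : {set {set V}}) (e f : {set V}) (es : seq {set V}).

Local Open Scope ring_scope.

(** The leaf expansion for constant lists; see [count_col_chrom]. *)
Definition chrom (es : seq {set V}) : R :=
  \sum_(B <- leaves set0 es) (-1) ^+ #|B| * k%:R ^+ ncomp B.

(** The gain guaranteed by the leaf [[set e]]; the quotient stands for [k^(#|V| - r)] and avoids
    truncated subtraction. *)
Let a e : R := k%:R ^+ #|V| / k%:R ^+ r * (defect L k e)%:R.

Let x : R := k%:R^-1.

(* The weight of the edges of a leaf with [j] edges: [1] for [j = 1], [- x^(p-1+j-1)] for
   even [j] and [0] for odd [j >= 3]; this form makes its sum a binomial expansion. *)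
Let u (j : nat) : R :=
  (j == 1)%:R - x ^+ p.-1 * ((x ^+ j.-1 - (- x) ^+ j.-1) / 2%:R).

Let a_ge0 e : 0 <= a e.
Proof. by rewrite mulr_ge0 ?divr_ge0 ?exprn_ge0 ?ler0n. Qed.

Let k_pos : 0 < k%:R :> R.
Proof. by rewrite ltr0n. Qed.

Let x_pos : 0 < x.
Proof. by rewrite invr_gt0. Qed.

Let u_odd j : ~~ odd j.+1 -> u j.+1 = - x ^+ (p.-1 + j).
Proof.
rewrite /= negbK => oj; rewrite /u /= exprNn -signr_odd oj expr1 exprD.
have -> : (j.+1 == 1)%N = false by apply/eqP => -[jE]; rewrite jE in oj.
by rewrite mulr0n; field.
Qed.

Let u_even j : odd j.+1 -> u j.+1 = (j.+1 == 1)%:R.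
Proof.
rewrite /= => oj; rewrite /u /= exprNn -signr_odd (negPf oj) expr0 mul1r.
by rewrite subrr mul0r mulr0 subr0.
Qed.

Let gap B : R := k%:R ^+ ncomp B - (count_col L B [::])%:R.

Let gap_ge0 B : 0 <= gap B.
Proof. by rewrite subr_ge0 -natrX ler_nat (count_col_le c0 card_L). Qed.

(** By the rank bound, [ncomp B - 1] is at most [#|V| - r - (p - 1) - (#|B| - 1)] in
    [count_col_deficit]. *)
Let gap_le B : B \in leaves set0 (enum E) -> (1 < #|B|)%N ->
  gap B <= \sum_(e in B) a e * x ^+ (p.-1 + #|B|.-1).
Proof.
move=> BE B1.
have BsubE : {subset B <= E}.
  by move=> e /(sub_leaves BE); rewrite !inE mem_enum.
have B0 e : e \in B -> e != set0.
  by move=> /BsubE /E_unif; apply: contra_eqN => /eqP->; rewrite cards0; lia.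
have rB : (ncomp B + rank_bound r p #|B| <= #|V|)%N.
  apply: (@leaves_rank V E r p E_unif E_diff p_gt1 p_ltr set0 (enum E)) => //.
  - exact: sub0set.
  - by move=> e; rewrite mem_enum.
  - exact: enum_uniq.
  - by move=> e _; rewrite inE.
  - by rewrite cards0 addn0 ncomp0.
have := count_col_deficit c0 card_L B0.
rewrite -(ler_nat R) natrD !natrM natrX natr_sum => hd.
have -> : \sum_(e in B) a e * x ^+ (p.-1 + #|B|.-1) =
    k%:R ^+ #|V| / k%:R ^+ r * x ^+ (p.-1 + #|B|.-1) *
    \sum_(e in B) (defect L k e)%:R.
  by rewrite mulr_sumr; apply: eq_bigr => e _; rewrite /a mulrAC.
apply: (@le_trans _ _ (k%:R ^+ ncomp B / k%:R * \sum_(e in B) (defect L k e)%:R)).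
  rewrite mulrAC ler_pdivlMr // /gap mulrBl mulrC [X in _ - X]mulrC.
  by rewrite lerBlDl.
apply: ler_wpM2r; first by apply: sumr_ge0 => e _; rewrite ler0n.
rewrite ler_pdivrMr //.
have -> : k%:R ^+ #|V| / k%:R ^+ r * x ^+ (p.-1 + #|B|.-1) * k%:R =
    k%:R ^+ #|V| * k%:R / k%:R ^+ (r + (p.-1 + #|B|.-1)) :> R.
  by rewrite /x exprVn [in RHS]exprD invfM -!mulrA; congr (_ * _); rewrite mulrA mulrC.
rewrite ler_pdivlMr ?exprn_gt0 // -exprD -exprSr.
by rewrite ler_weXn2l ?ler1n //; case: #|B| B1 rB => [|[|j]] //= _; lia.
Qed.

Let gap_set1 e : e \in E -> a e <= gap [set e].
Proof.
move=> eE; have e0 : e != set0.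
  by move: (E_unif eE); apply: contra_eqN => /eqP->; rewrite cards0; lia.
have := count_col_set1 c0 card_L e0.
rewrite -(ler_nat R) natrD natrM !natrX /gap -lerBrDr; apply: le_trans.
apply: ler_wpM2r; first exact: ler0n.
rewrite ler_pdivrMr ?exprn_gt0 // -exprD ler_weXn2l ?ler1n //.
by have := ncomp1 e0; rewrite (E_unif eE); lia.
Qed.

(** Leaves of even size lose their gap, bounded by [gap_le]; those of odd size gain it, and the gain
    is kept only for single edges. The empty leaf has gap zero. *)
Let term_ge B : B \in leaves set0 (enum E) ->
  \sum_(e in B) a e * u #|B| <=
  (-1) ^+ #|B| * (count_col L B [::])%:R - (-1) ^+ #|B| * k%:R ^+ ncomp B.
Proof.
move=> BE; rewrite -mulrBr -opprB -/(gap B) mulrN -signr_odd.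
case cB : #|B| => [|j].
  move/eqP: cB; rewrite cards_eq0 => /eqP->; rewrite big_set0 expr0 mul1r oppr_ge0.
  have := @count_col_deficit V C L k c0 card_L set0.
  rewrite big_set0 muln0 addn0 leq_mul2l eqn0Ngt k_gt0 /= => h.
  by rewrite subr_le0 -natrX ler_nat h // => e; rewrite inE.
case oj : (odd j.+1); last first.
  rewrite expr0 mul1r u_odd ?oj // lerNr -sumrN.
  under eq_bigr do rewrite mulrN opprK.
  rewrite -[j]/(j.+1.-1) -cB; apply: gap_le => //.
  by rewrite cB; case: (j) oj.
rewrite expr1 mulN1r opprK u_even //.
case: j cB oj => [|j] cB _; last by rewrite big1 // => e _; rewrite mulr0.
move/eqP/cards1P: cB BE => [e ->] /sub_leaves /(_ e (set11 e)).
by rewrite !inE mem_enum big_set1 mulr1; apply: gap_set1.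
Qed.

Lemma chrom_le_count_col :
  (1 + k%:R^-1) ^+ #|E|.-1 <= 2%:R * k%:R ^+ p.-1 :> R ->
  chrom (enum E) <= (count_col L set0 (enum E))%:R.
Proof.
move=> hk; rewrite count_col_leaves ?enum_uniq //; last by move=> e _; rewrite inE.
rewrite cards0 -subr_ge0 -sumrB.
pose t B := \sum_(e in B) a e * u #|B|.
apply: (@le_trans _ _ (\sum_(B <- leaves set0 (enum E)) t B)); last first.
  by rewrite big_seq [leRHS]big_seq; apply: ler_sum => B; apply: term_ge.
(* Passing from leaves to all subsets can only lower the sum: every singleton is a leaf, and any
   other set has weight at most zero. *)
apply: (@le_trans _ _ (\sum_(B : {set {set V}} | B \subset E) t B)); last first.
  have Ul : uniq (leaves set0 (enum E)).
    by apply: leaves_uniq; [exact: enum_uniq | move=> e _; rewrite inE].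
  rewrite (big_uniq _ Ul) (bigID (mem (leaves set0 (enum E)))) /=.
  rewrite (eq_bigl (mem (leaves set0 (enum E)))) /=; last first.
    move=> B; rewrite andb_idl // => /sub_leaves BE; apply/subsetP => e /BE.
    by rewrite !inE mem_enum.
  rewrite gerDl; apply: sumr_le0 => B /andP[BE Bl].
  rewrite /t; case cB : #|B| => [|j].
    by move/eqP: cB; rewrite cards_eq0 => /eqP->; rewrite big_set0.
  case oj : (odd j.+1); last first.
    rewrite u_odd ?oj //; apply: sumr_le0 => e _.
    by rewrite mulrN oppr_le0 mulr_ge0 ?exprn_ge0 // ltW.
  rewrite u_even //; case: j cB oj => [|j] cB _; last first.
    by rewrite big1 // => e _; rewrite mulr0.
  move/eqP/cards1P: cB BE Bl => [e ->]; rewrite sub1set => eE /negP[].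
  apply: leaves_set1; rewrite ?mem_enum ?enum_uniq //.
    by move=> f; rewrite mem_enum; apply: (spanned0N E_unif p_gt1 p_ltr).
  by move=> f; rewrite mem_enum => fE fe; apply: (spanned1N E_unif E_diff p_gt1 p_ltr).
(* With [m = #|E|], the coefficient of [a e] is at least [1 - x^(p-1) ((1+x)^(m-1) - (1-x)^(m-1)) /
   2]. Dropping the last power leaves exactly [hk]. *)
rewrite /t (exchange_big_dep (mem E)) /=; last by move=> B e /subsetP BE /BE.
apply: sumr_ge0 => e eE; rewrite -mulr_sumr mulr_ge0 // /u big_split /= sumrN.
rewrite -mulr_sumr -mulr_suml sumrB !sum_subsets_pointed //.
rewrite subr_ge0; apply: (@le_trans _ _ 1).
  rewrite /x exprVn mulrC ler_pdivrMr ?exprn_gt0 // mul1r ler_pdivrMr ?ltr0n //.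
  rewrite mulrC; apply: le_trans hk; rewrite gerDl oppr_le0 exprn_ge0 //.
  by rewrite subr_ge0 invf_le1 // ler1n.
rewrite (bigD1 [set e]) /=; last by rewrite sub1set eE set11.
by rewrite cards1 eqxx lerDl sumr_ge0 // => B _; rewrite ler0n.
Qed.

End Comparison.

(** * Constant lists, and pairwise disjoint edges *)

Lemma eq_mono (V C : finType) (f g : V -> C) (e : {set V}) :
  {in e, f =1 g} -> mono f e = mono g e.
Proof.
by move=> fg; apply/monoP/monoP => h x y xe ye; move: (h x y xe ye); rewrite !fg.
Qed.

Section ConstantAndDisjoint.
Variables (V C : finType) (L : V -> {set C}) (k : nat) (c0 : C).
Hypothesis card_L : forall v, #|L v| = k.
Implicit Types (A B : {set {set V}}) (e f : {set V}) (es : seq {set V}).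

Lemma count_col_chrom (R : realFieldType) es : (forall u v, L u = L v) ->
  uniq es -> ((count_col L set0 es)%:R = chrom R k es)%R.
Proof.
move=> Lc Ues; rewrite count_col_leaves //; last by move=> e _; rewrite inE.
apply: eq_bigr => B _; rewrite cards0 (count_col_const c0 card_L) // natrX //.
Qed.

Lemma count_col0 : count_col L set0 [::] = k ^ #|V|.
Proof.
rewrite (count_col_nil L c0) (eq_bigl xpredT) => [|t]; last by rewrite crep0 eqxx.
rewrite -prod_nat_const; apply: eq_bigr => t _.
rewrite -(common1 card_L t); congr #|common L _|; apply/setP => v.
by rewrite !inE !crep0.
Qed.

(* Exchanging the values on [e] of two colorings shows that being constant on [e] is
   independent of being non-constant on edges disjoint from [e]. *)
Lemma count_col_indep e es : (forall f, f \in es -> [disjoint e & f]) ->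
  count_col L [set e] es * k ^ #|V| = count_col L [set e] [::] * count_col L set0 es.
Proof.
move=> dis; rewrite -count_col0 /count_col -!cardsX.
pose g (q : {ffun V -> C} * {ffun V -> C}) : {ffun V -> C} * {ffun V -> C} :=
  ([ffun v => if v \in e then q.1 v else q.2 v],
   [ffun v => if v \in e then q.2 v else q.1 v]).
have gK : involutive g.
  by move=> [a b]; congr pair; apply/ffunP => v; rewrite !ffunE /=; case: ifP => ve; rewrite ve.
rewrite -(card_imset _ (inv_inj gK)); apply: eq_card => -[a b].
rewrite -{1}[(a, b)]gK (mem_imset _ _ (inv_inj gK)).
have mono1 (f : {ffun V -> C}) : [forall h in [set e], mono f h] = mono f e.
  apply/forall_inP/idP => [h|h e']; first by apply: h; rewrite inE.
  by rewrite inE => /eqP->.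
have mono0 (f : {ffun V -> C}) : [forall h in set0, mono f h].
  by apply/forall_inP => h; rewrite inE.
rewrite !inE /= !mono1 !mono0 !andbT /=.
set a' := finfun _; set b' := finfun _.
have resp : respects L a' && respects L b' = respects L a && respects L b.
  apply/andP/andP => -[/forallP ha /forallP hb]; split; apply/forallP => v;
    by move: (ha v) (hb v); rewrite !ffunE; case: ifP.
have -> : mono a' e = mono a e.
  by apply: eq_mono => v ve; rewrite ffunE ve.
have -> : all (fun f => ~~ mono a' f) es = all (fun f => ~~ mono b f) es.
  apply: eq_in_all => f fes; congr negb; apply: eq_mono => v vf.
  by rewrite ffunE (disjointFl (dis f fes)).
move: resp; do 4!case: (respects L _) => //=; case: (mono a e) => //=.
all: by rewrite ?andbT ?andbF.
Qed.

Lemma count_col_cons_disjoint e es : (forall f, f \in es -> [disjoint e & f]) ->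
  count_col L set0 (e :: es) * k ^ #|V| =
  count_col L set0 es * (k ^ #|V| - count_col L [set e] [::]).
Proof.
move=> dis; rewrite mulnBr [X in _ - X]mulnC -count_col_indep //.
by rewrite -mulnBl -(count_col_cons L set0 e es) setU0 addnK.
Qed.

End ConstantAndDisjoint.

(** By independence each edge multiplies the count by the proportion of choices not constant on it,
    which is smallest for constant lists. *)
Lemma count_col_disjoint_le (V C C' : finType) (L : V -> {set C}) (L' : V -> {set C'})
    (k : nat) (c0 : C) (c0' : C') es :
  0 < k -> (forall v, #|L v| = k) -> (forall v, #|L' v| = k) ->
  (forall u v, L' u = L' v) -> pairwise (fun e f : {set V} => [disjoint e & f]) es ->
  count_col L' set0 es <= count_col L set0 es.
Proof.
move=> k_gt0 cL cL' L'c; elim: es => [|e es IH] /=.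
  by rewrite (count_col0 c0 cL) (count_col0 c0' cL').
move=> /andP[/allP dis /IH {}IH].
rewrite -(leq_pmul2r (_ : 0 < k ^ #|V|)) ?expn_gt0 ?k_gt0 //.
rewrite (count_col_cons_disjoint c0 cL dis) (count_col_cons_disjoint c0' cL' dis).
apply: leq_mul => //; apply: leq_sub2l.
by rewrite (count_col_const c0' cL') // (count_col_le c0 cL).
Qed.

(** * From the hypergraph definitions to counts over finite types *)

Lemma rho_le (H : hypergraph) e f : e \in edges H -> f \in edges H -> e != f ->
  rho H <= #|e :\: f|.
Proof.
move=> eE fE ef.
apply: (@bigmin_le_cond _ nat _ #|vertex H| (e, f)
  (fun q => (q \in setX (edges H) (edges H)) && (q.1 != q.2)) (fun q => #|q.1 :\: q.2|)).
by rewrite inE /= eE fE.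
Qed.

Lemma card_fset_gt1P (K : choiceType) (A : {fset K}) :
  reflect (exists a b, [/\ a \in A, b \in A & a != b]) (1 < #|` A|).
Proof.
apply: (iffP idP) => [A1|[a [b [aA bA ab]]]].
  have /fset0Pn[a aA] : A != fset0 by rewrite -cardfs_gt0 ltnW.
  have /fset0Pn[b] : (A `\ a)%fset != fset0.
    by rewrite -cardfs_gt0; move: A1; rewrite (cardfsD1 a) aA.
  by rewrite !inE => /andP[ba bA]; exists a, b; rewrite eq_sym.
by rewrite (cardfsD1 a) aA (cardfsD1 b) !inE eq_sym ab bA.
Qed.

Lemma non_monochromaticP (H : hypergraph) (K : choiceType) (theta : vertex H -> K) :
  reflect (forall e, e \in edges H ->
             exists x y, [/\ x \in e, y \in e & theta x != theta y])
    (non_monochromatic theta).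
Proof.
apply: (iffP forall_inP) => h e /h.
  case/card_fset_gt1P=> _ [_ [/imfsetP[x xe ->] /imfsetP[y ye ->] xy]].
  by exists x, y.
case=> x [y [xe ye xy]]; apply/card_fset_gt1P; exists (theta x), (theta y).
by split=> //; apply/imfsetP; [exists x | exists y].
Qed.

Lemma non_monochromatic_mono (H : hypergraph) (C : finType) (theta : vertex H -> C) :
  non_monochromatic theta = all (fun e => ~~ mono theta e) (enum (edges H)).
Proof.
apply/non_monochromaticP/allP => h e; rewrite ?mem_enum => eE.
  have [x [y [xe ye]]] := h e eE; apply: contraNN => /monoP /(_ x y xe ye) ->.
  by rewrite eqxx.
have := h e; rewrite mem_enum => /(_ eE) /forall_inPn[x xe /forall_inPn[y ye xy]].
by exists x, y.
Qed.

Lemma num_coloringsE (H : hypergraph) k :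
  num_colorings H k =
  count_col (fun=> [set: 'I_k]) set0 (enum (edges H)).
Proof.
apply: eq_card => theta; rewrite !inE non_monochromatic_mono.
have -> : respects (fun=> [set: 'I_k]) theta by apply/forallP => v; rewrite inE.
suff -> : [forall e in set0, mono theta e] by [].
by apply/forall_inP => e; rewrite inE.
Qed.

Section Bounded.
Variables (H : hypergraph) (L : vertex H -> {fset nat}) (N : nat).
Hypothesis L_lt : forall v c, c \in L v -> c < N.+1.

(** A common bound on the colors places all lists in a single finite type. *)
Definition bounded_list (v : vertex H) : {set 'I_N.+1} := [set c | val c \in L v].

Lemma card_bounded_list v : #|bounded_list v| = #|` L v|.
Proof.
rewrite cardE -(size_map val); apply: perm_size; apply: uniq_perm.
- by rewrite map_inj_uniq ?enum_uniq //; apply: val_inj.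
- exact: fset_uniq.
move=> c; apply/mapP/idP => [[d]|cL]; first by rewrite mem_enum inE => ? ->.
by exists (Ordinal (L_lt cL)); rewrite // mem_enum inE.
Qed.

Lemma num_list_coloringsE :
  num_list_colorings L = count_col bounded_list set0 (enum (edges H)).
Proof.
pose g (theta : {dffun forall v : vertex H, L v}) : {ffun vertex H -> 'I_N.+1} :=
  [ffun v => Ordinal (L_lt (valP (theta v)))].
have g_inj : injective g.
  move=> f1 f2 /ffunP E; apply/ffunP => v; apply: val_inj.
  by have := E v; rewrite !ffunE => -[].
have nm (theta : {dffun forall v : vertex H, L v}) : non_monochromatic (fun v => val (theta v)) =
    non_monochromatic (g theta).
  by apply/non_monochromaticP/non_monochromaticP => h e /h [x [y [xe ye xy]]];
    exists x, y; split=> //; move: xy; rewrite !ffunE.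
rewrite /num_list_colorings -(card_imset _ g_inj); apply: eq_card => phi.
rewrite !inE -non_monochromatic_mono.
have -> : [forall e in set0, mono phi e] by apply/forall_inP => e; rewrite inE.
apply/imsetP/andP => [[theta]|[/forallP hr hm]].
  rewrite inE nm => h ->; split=> //; apply/forallP => v.
  by rewrite inE ffunE /= (valP (theta v)).
have hr' v : val (phi v) \in L v by have := hr v; rewrite inE.
have E : phi = g [ffun v => [` hr' v]%fset].
  by apply/ffunP => v; apply: val_inj; rewrite !ffunE.
by exists [ffun v => [` hr' v]%fset]; rewrite // inE nm -E.
Qed.

End Bounded.

Lemma bounded_lists (H : hypergraph) (L : vertex H -> {fset nat}) :
  exists N, forall v c, c \in L v -> c < N.+1.
Proof.
exists (\max_v \max_(c <- L v) c) => v c cL; rewrite ltnS.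
apply: leq_trans (leq_bigmax v); exact: leq_bigmax_seq.
Qed.

Lemma list_color_function_eq (R : realFieldType) (H : hypergraph) (r k : nat) :
  uniform r H -> 1 < rho H -> 1 < #|edges H| -> 0 < k ->
  ((1 + k%:R^-1) ^+ #|edges H|.-1 <= 2%:R * k%:R ^+ (rho H).-1 :> R)%R ->
  list_color_function H k = num_colorings H k.
Proof.
move=> Hr rho1 E1 k0 hk; rewrite /list_color_function.
have c0 : 'I_k by exists 0.
have cT (v : vertex H) : #|[set: 'I_k]| = k by rewrite cardsT card_ord.
(* Both counts equal [chrom], which depends on [k] but not on the colors themselves. *)
have num_const (L : vertex H -> {fset nat}) : assignment k L ->
    (forall u v, L u = L v) -> num_list_colorings L = num_colorings H k.
  move=> Lk Lc; have [N LN] := bounded_lists L.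
  apply/eqP; rewrite -(eqr_nat R) (num_list_coloringsE LN) num_coloringsE; apply/eqP.
  rewrite (@count_col_chrom _ _ _ k ord0) ?enum_uniq //; last first.
  - by move=> u v; rewrite /bounded_list (Lc u v).
  - by move=> v; rewrite card_bounded_list //; case: (Lk v).
  by rewrite (@count_col_chrom _ _ _ k c0) ?enum_uniq.
have num_le (L : vertex H -> {fset nat}) : assignment k L ->
    num_colorings H k <= num_list_colorings L.
  move=> Lk; have [N LN] := bounded_lists L.
  have cL v : #|bounded_list L N v| = k by rewrite card_bounded_list //; case: (Lk v).
  rewrite (num_list_coloringsE LN) num_coloringsE.
  (* If [r <= rho H], then [e :\: f] is all of [e] for distinct edges, so the edges are pairwise
     disjoint. *)
  have [p_ltr|r_le] := ltnP (rho H) r.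
    rewrite -(ler_nat R) (@count_col_chrom _ _ _ k c0) ?enum_uniq //.
    by apply: (chrom_le_count_col ord0 Hr (@rho_le H)).
  apply: (count_col_disjoint_le ord0 c0 k0 cL cT) => //.
  apply: (@sub_in_pairwise _ (mem (edges H)) [rel e f | e != f]).
  - move=> e f eE fE /= ef; rewrite -setI_eq0 -cards_eq0.
    by have := rho_le eE fE ef; have := cardsID f e; rewrite (Hr e eE); lia.
  - by apply/allP => e; rewrite mem_enum.
  by rewrite -uniq_pairwise enum_uniq.
apply/eqP; rewrite eqn_leq; apply/andP; split; last first.
  by case: ex_minnP => n /boolp.asboolP[L [Lk <-]] _; apply: num_le.
case: ex_minnP => n _; apply; apply/boolp.asboolP.
exists (fun=> [fset i in iota 1 k]%fset); split; last first.
  apply: num_const => // v; split; last by move=> c; rewrite !inE mem_iota => /andP[].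
  by rewrite card_fseq undup_id ?iota_uniq // size_iota.
move=> v; split; last by move=> c; rewrite !inE mem_iota => /andP[].
by rewrite card_fseq undup_id ?iota_uniq // size_iota.
Qed.

(* The numerical condition on [k] *)
From mathcomp Require Import all_classical all_reals all_analysis.
Import Order.TTheory GRing.Theory Num.Theory.
Local Open Scope ring_scope.

(** The first seven terms of the series add up to [1957/720], just above [2.718]. *)
Lemma expR1_ge (R : realType) : 2718%:R / 1000%:R <= expR 1 :> R.
Proof.
apply: (@le_trans _ _ (series (exp_coeff (1 : R)) 7)); last first.
  apply: nondecreasing_cvgn_le; last exact: is_cvg_series_exp_coeff.
  apply/nondecreasing_seqP => n; rewrite seriesSr lerDl.
  by rewrite /exp_coeff /= expr1n mul1r invr_ge0 ler0n.
have -> : series (exp_coeff 1) 7 =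
    1%:R^-1 + 1%:R^-1 + 2%:R^-1 + 6%:R^-1 + 24%:R^-1 + 120%:R^-1 + 720%:R^-1 :> R.
  rewrite /series /= !big_nat_recr // big_geq // /exp_coeff /= !expr1n !mul1r.
  by rewrite add0r.
by lra.
Qed.

(** Concavity of [ln], from [ln (1 + y) <= y] at [y = x/a - 1]. *)
Lemma ln_tangent (R : realType) (x a : R) : 0 < x -> 0 < a -> ln x <= x / a - 1 + ln a.
Proof.
move=> x0 a0; have xa0 : 0 < x / a by rewrite divr_gt0.
have -> : ln x = ln (x / a) + ln a by rewrite -lnM ?posrE // divfK // gt_eqF.
rewrite lerD2r; have := @le_ln1Dx R (x / a - 1).
by rewrite [1 + _]addrC subrK; apply; lra.
Qed.

Section Growth.
Variable R : realType.

(* The logarithm of [(1 + 1/k)^(m-1) <= 2 k^(p-1)] at the least admissible [k], with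
   [1 + 1/k] replaced by [exp (1/k)] and with [l = ln (m - 1)]. *)
Definition growth (p : nat) (l : R) :=
  5%:R / 12%:R * (p%:R * l) <=
  ln 2%:R + p.-1%:R * (ln (12%:R / 5%:R) + l - ln p%:R - ln l) :> R.

(* Replacing [ln l] by its tangent at [a] leaves an inequality affine in [l]; [Q / N] is
   the slope, and at [l = ln (p^3 / 2)] the exponential of [N] times it is numeric. *)
Lemma growth_tangent (p N Q : nat) (a l : R) : (1 < p)%N -> (0 < N)%N -> 0 < a -> 0 < l ->
  ln (p%:R ^+ 3 / 2%:R) <= l ->
  Q%:R = N%:R * (p.-1%:R * (1 - a^-1) - 5%:R / 12%:R * p%:R) :> R ->
  (p%:R * a * 5%:R / 12%:R) ^+ (N * p.-1) <=
    2%:R ^+ N * (2718%:R / 1000%:R) ^+ (N * p.-1) * (p%:R ^+ 3 / 2%:R) ^+ Q :> R ->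
  growth p l.
Proof.
move=> p1 N0 a0 l0 pl QE num; rewrite /growth.
have pN : (0 < p)%N by apply: ltnW.
have p0 : 0 < p%:R :> R by rewrite ltr0n.
have p3 : 0 < p%:R ^+ 3 / 2%:R :> R by rewrite divr_gt0 ?exprn_gt0 ?ltr0n.
have u0 : 0 < p%:R * a * 5%:R / 12%:R by rewrite divr_gt0 ?mulr_gt0 ?ltr0n.
have lnu : ln (p%:R * a * 5%:R / 12%:R) = ln p%:R + ln a - ln (12%:R / 5%:R) :> R.
  have -> : p%:R * a * 5%:R / 12%:R = p%:R * a / (12%:R / 5%:R) by field.
  rewrite ln_div ?posrE ?mulr_gt0 ?divr_gt0 ?ltr0n //.
  by rewrite lnM ?posrE.
have hQ : N%:R * (p.-1%:R * ln (p%:R * a * 5%:R / 12%:R)) <=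
    N%:R * ln 2%:R + N%:R * p.-1%:R + Q%:R * ln (p%:R ^+ 3 / 2%:R) :> R.
  have E1 : expR (N%:R * p.-1%:R) = expR 1 ^+ (N * p.-1) :> R.
    by rewrite -natrM -{1}[(_ * _)%N%:R]mulr1 expRM_natl.
  have -> (y : R) : N%:R * (p.-1%:R * y) = y *+ (N * p.-1).
    by rewrite -[RHS]mulr_natr natrM; ring.
  rewrite -lnXn // -[leRHS]expRK ler_ln ?posrE ?expR_gt0 ?exprn_gt0 //.
  apply: le_trans num _; rewrite !expRD E1.
  rewrite !expRM_natl !lnK ?posrE ?ltr0n //.
  apply: ler_wpM2r; first exact/exprn_ge0/ltW.
  apply: ler_wpM2l; first by rewrite exprn_ge0 ?ler0n.
  by apply: lerXn2r; rewrite ?nnegrE ?expR_ge0 ?divr_ge0 ?ler0n // expR1_ge.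
have hl := ln_tangent l0 a0.
have N0' : 0 < N%:R :> R by rewrite ltr0n.
have p1' : 0 <= p.-1%:R :> R by rewrite ler0n.
have hQl : Q%:R * ln (p%:R ^+ 3 / 2%:R) <= Q%:R * l :> R by apply: ler_wpM2l; rewrite ?ler0n.
have ht : p.-1%:R * ln l <= p.-1%:R * (l / a - 1 + ln a) :> R by apply: ler_wpM2l.
rewrite -(ler_pM2l N0'); move: hQ hQl; rewrite QE lnu => hQ hQl.
have ht' : N%:R * (p.-1%:R * ln l) <= N%:R * (p.-1%:R * (l / a - 1 + ln a)) :> R.
  exact: ler_wpM2l (ltW N0') _ _ ht.
by lra.
Qed.

Lemma growth_large (p : nat) (l : R) : (8 < p)%N -> 0 < l ->
  ln (p%:R ^+ 3 / 2%:R) <= l -> growth p l.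
Proof.
move=> p9 l0; have pN : (0 < p)%N by lia.
have p0 : 0 < p%:R :> R by rewrite ltr0n.
rewrite ln_div ?posrE ?exprn_gt0 ?ltr0n // lnXn // => pl.
have a0 : 0 < 96%:R / 19%:R :> R by rewrite divr_gt0 ?ltr0n.
have ht := ln_tangent l0 a0; rewrite /growth.
have l2 : 0 <= ln 2%:R :> R by rewrite ln_ge0 // ler1n.
pose c : R := ln (12%:R / 5%:R) + l - ln p%:R - ln l.
(* The constant [15/32] is [5/12] times [9/8], the largest value of [p / (p-1)] for [p >= 9]. The
   tangent point [96/19] gives [1 - 1/3 - 19/96 = 15/32], where [1/3] comes from
   [ln p <= (l + ln 2) / 3]. *)
have hc : 15%:R / 32%:R * l <= c.
  have num : 0 <= 3%:R * ln (12%:R / 5%:R) - ln 2%:R + 3%:R - 3%:R * ln (96%:R / 19%:R) :> R.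
    rewrite ![3%:R * ln _]mulr_natl -!lnXn ?divr_gt0 ?ltr0n // -[3%:R]expRK.
    have E3 : expR 3%:R = expR 1 ^+ 3 :> R by rewrite -expRM_natl mulr1.
    rewrite -!ln_div ?posrE ?exprn_gt0 ?divr_gt0 ?ltr0n //.
    rewrite -lnM ?posrE ?expR_gt0 ?divr_gt0 ?exprn_gt0 ?divr_gt0 ?ltr0n //.
    rewrite -ln_div ?posrE ?mulr_gt0 ?expR_gt0 ?divr_gt0 ?exprn_gt0 ?divr_gt0 ?ltr0n //.
    apply: ln_ge0; rewrite E3 ler_pdivlMr ?exprn_gt0 // mul1r.
    apply: (@le_trans _ _ ((12%:R / 5%:R) ^+ 3 / 2%:R * (2718%:R / 1000%:R) ^+ 3)); first by lra.
    apply: ler_wpM2l; first by rewrite divr_ge0 ?exprn_ge0 ?divr_ge0 ?ler0n.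
    by apply: lerXn2r; rewrite ?nnegrE ?expR_ge0 ?divr_ge0 ?ler0n // expR1_ge.
  move: ht pl num; rewrite /c invf_div => ht pl num.
  by rewrite -[ln _ *+ _]mulr_natl in pl; lra.
have p1 : p%:R = p.-1%:R + 1 :> R by rewrite natr1 prednK //; lia.
have p8 : 8%:R <= p.-1%:R :> R by rewrite ler_nat; lia.
have : p.-1%:R * (15%:R / 32%:R * l) <= p.-1%:R * c by apply: ler_wpM2l; rewrite ?ler0n.
have : 8%:R * l <= p.-1%:R * l by rewrite ler_pM2r.
by rewrite -/c p1; lra.
Qed.

Lemma growth_ge2 (p : nat) (l : R) : (1 < p)%N -> 0 < l ->
  ln (p%:R ^+ 3 / 2%:R) <= l -> growth p l.
Proof.
move=> p1 l0 pl; case: (ltnP 8 p) => p8; first exact: growth_large.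
(* The tangent points lie near [ln (p^3 / 2)] for [p >= 4], the case [p = 5] being nearly
   tight; for [p = 2, 3] the slope is made to vanish. *)
case: p p1 p8 pl => [|[|[|[|[|[|[|[|[|]]]]]]]]] // _ _ pl.
- by apply: (@growth_tangent _ 1%N 0%N 6%:R) => //; rewrite /=; lra.
- by apply: (@growth_tangent _ 1%N 0%N (8%:R / 3%:R)) => //; rewrite /= ?invf_div; lra.
- by apply: (@growth_tangent _ 2%N 1%N (36%:R / 10%:R)) => //; rewrite /= ?invf_div; lra.
- by apply: (@growth_tangent _ 12%N 11%N 4%:R) => //; rewrite /=; lra.
- by apply: (@growth_tangent _ 2%N 3%N 5%:R) => //; rewrite /=; lra.
- by apply: (@growth_tangent _ 1%N 2%N (72%:R / 13%:R)) => //; rewrite /= ?invf_div; lra.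
- by apply: (@growth_tangent _ 2%N 5%N 6%:R) => //; rewrite /=; lra.
Qed.

(** Since [(1 + 1/k)^M <= exp (M/k)], it suffices that [M/k <= ln 2 + (p-1) ln k]. The lower bound
    on [k] controls both [M/k] and [ln k], and [growth] compares the two estimates. *)
Lemma expr_bound (p M k : nat) : (1 < p)%N -> (0 < M)%N ->
  p%:R ^+ 3 / 2%:R <= M%:R :> R ->
  (24%:R / 10%:R * M%:R) / (p%:R * ln M%:R) <= k%:R :> R ->
  (1 + k%:R^-1) ^+ M <= 2%:R * k%:R ^+ p.-1 :> R.
Proof.
move=> p1 M0 pM hk; set l := ln _ in hk.
have pN : (0 < p)%N by apply: ltnW.
have p0 : 0 < p%:R :> R by rewrite ltr0n.
have p3 : 0 < p%:R ^+ 3 / 2%:R :> R by rewrite divr_gt0 ?exprn_gt0 ?ltr0n.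
have M0' : 0 < M%:R :> R by rewrite ltr0n.
have M1 : 1 < M%:R :> R.
  apply: lt_le_trans pM; rewrite ltr_pdivlMr ?ltr0n // mul1r.
  by apply: (@lt_le_trans _ _ (2%:R ^+ 3)); [lra | rewrite -!natrX ler_nat leq_exp2r].
have l0 : 0 < l by apply: ln_gt0.
have pl : ln (p%:R ^+ 3 / 2%:R) <= l by rewrite ler_ln ?posrE.
have k00 : 0 < 24%:R / 10%:R * M%:R / (p%:R * l).
  by rewrite divr_gt0 ?mulr_gt0 ?invr_gt0 ?ltr0n.
have k0 : 0 < k%:R :> R := lt_le_trans k00 hk.
have hlk : ln (12%:R / 5%:R) + l - ln p%:R - ln l <= ln k%:R.
  have : ln (24%:R / 10%:R * M%:R / (p%:R * l)) <= ln k%:R by rewrite ler_ln ?posrE.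
  rewrite ln_div ?posrE ?mulr_gt0 ?invr_gt0 ?ltr0n // lnM ?posrE ?divr_gt0 ?ltr0n //.
  rewrite lnM ?posrE // -/l.
  have -> : 24%:R / 10%:R = 12%:R / 5%:R :> R by lra.
  by lra.
have hMk : M%:R / k%:R <= 5%:R / 12%:R * (p%:R * l).
  rewrite ler_pdivrMr //; move: hk; rewrite ler_pdivrMr ?mulr_gt0 // => hk.
  by lra.
have : M%:R / k%:R <= ln 2%:R + p.-1%:R * ln k%:R :> R.
  apply: le_trans hMk _.
  have := growth_ge2 p1 l0 pl; rewrite /growth => /le_trans; apply.
  by rewrite lerD2l ler_wpM2l ?ler0n.
have kN : (0 < k)%N by rewrite -(ltr0n R).
rewrite -ler_expR expRD !expRM_natl !lnK ?posrE ?ltr0n //; apply: le_trans.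
by apply: lerXn2r; rewrite ?nnegrE ?expR_ge0 ?addr_ge0 ?invr_ge0 ?ler0n // expR_ge1Dx.
Qed.

End Growth.

Theorem theorem1 (R : realType) (H : hypergraph) (r m : nat)
  (r_ge3 : (3 <= r)%N) (m_ge2 : (2 <= m)%N)
  (H_unif : uniform r H) (H_card : #|edges H| = m)
  (rho_ge2 : (2 <= rho H)%N)
  (m_ge : m%:R >= (rho H)%:R ^+ 3 / 2%:R + 1 :> R) :
  forall k : nat, (0 < k)%N ->
    k%:R >= (24%:R / 10%:R * (m%:R - 1)) / ((rho H)%:R * ln (m%:R - 1)) :> R ->
    list_color_function H k = num_colorings H k.
Proof.
move=> k k_gt0 k_ge; have E1 : (1 < #|edges H|)%N by rewrite H_card.
apply: (list_color_function_eq H_unif rho_ge2 E1 k_gt0 (R := R)); rewrite H_card.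
have mE : m%:R - 1 = m.-1%:R :> R by rewrite -{1}(prednK (ltnW m_ge2)) -natr1 addrK.
apply: (expr_bound rho_ge2); first by rewrite -subn1 subn_gt0.
  by rewrite -mE lerBrDr.
by rewrite -mE.
Qed.
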